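(* Let $(G,\tau)$, $(K,\rho)$, $(H,\sigma)$ be topological groups, let $f_1:(G,\tau)\to(K,\rho)$ and $f_2:(K,\rho)\to(H,\sigma)$ be continuous group isomorphisms, and let $f=f_2\circ f_1$. If $f$ is semitopological, then $f_1$ is semitopological.
   Context: Topological groups are not assumed Hausdorff. A continuous isomorphism is a bijective continuous homomorphism (its inverse need not be continuous). A continuous surjective homomorphism $f:(G,\tau)\to(H,\sigma)$ of topological groups is semitopological if there exist a topological group $(\widetilde G,\widetilde\tau)$ containing $G$ as a topological normal subgroup (i.e. $G$ is, up to identification, a normal subgroup of $\widetilde G$ and $\widetilde\tau\restriction_G=\tau$) and an open continuous homomorphism $\widetilde f:(\widetilde G,\widetilde\tau)\to(H,\sigma)$ extending $f$. *)

(* Defs.v *)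
From HB Require Import structures.
From mathcomp Require Import all_boot all_classical.
From mathcomp Require Import topology.

Set Implicit Arguments.
Unset Strict Implicit.
Unset Printing Implicit Defensive.

Local Open Scope classical_set_scope.
Local Open Scope group_scope.

HB.structure Definition PreTopologicalGroup :=
  {G of Topological G & Group G}.

(* No separation axiom is imposed. *)
HB.mixin Record PreTopologicalGroup_isTopologicalGroup G
    & PreTopologicalGroup G := {
  mulg_continuous : continuous (fun x : G * G => x.1 * x.2) ;
  invg_continuous : continuous (fun x : G => x^-1) ;
}.

#[short(type="topologicalGroupType")]
HB.structure Definition TopologicalGroup :=
  {G of PreTopologicalGroup G & PreTopologicalGroup_isTopologicalGroup G}.

Definition continuous_homomorphism (G H : topologicalGroupType) (f : G -> H) :=
  monoid_morphism f /\ continuous f.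

(* The inverse of f is not required to be continuous. *)
Definition continuous_isomorphism (G H : topologicalGroupType) (f : G -> H) :=
  continuous_homomorphism f /\ bijective f.

Definition open_map (X Y : topologicalType) (f : X -> Y) :=
  forall U : set X, open U -> open (f @` U).

Definition normal_subgroup (G : groupType) (N : set G) :=
  [/\ N 1,
      forall x y, N x -> N y -> N (x * y),
      forall x, N x -> N x^-1
    & forall x g, N x -> N (x ^ g)].

(* The identification of G with a normal subgroup of Gt carrying the subspace
   topology: the last clause says that the topology of G is the trace of the
   topology of Gt along i. *)
Definition topological_normal_embedding
    (G Gt : topologicalGroupType) (i : G -> Gt) :=
  [/\ monoid_morphism i,
      injective i,
      normal_subgroup (range i)
    & forall U : set G,
        open U <-> exists2 V : set Gt, open V & U = i @^-1` V].

Definition semitopological (G H : topologicalGroupType) (f : G -> H) :=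
  [/\ continuous_homomorphism f,
      set_surj [set: G] [set: H] f
    & exists (Gt : topologicalGroupType) (i : G -> Gt) (ft : Gt -> H),
        [/\ topological_normal_embedding i,
            continuous_homomorphism ft,
            open_map ft
          & forall x : G, ft (i x) = f x]].

(* Main.v *)
Require Import Defs.
From mathcomp Require Import all_boot all_classical.
From mathcomp Require Import topology.
From HB Require Import structures.

(** Write f = f2 o f1 and let ft : Gt -> H be an open extension of f.  The
    witness for f1 is the fibre product of ft and f2, the subgroup of Gt * K
    of the pairs (x, k) with ft x = f2 k, with the subspace topology and its
    projection to K.  That projection is open because ft is, openness being
    preserved by pullback along the continuous f2; and G embeds through
    x |-> (i x, f1 x), which induces the original topology of G because f1 is
    continuous.  Conjugation by (x, k) maps (i a, f1 a) to (i b, f1 a ^ k),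
    where i b = i a ^ x; applying f2 gives f2 (f1 b) = f2 (f1 a ^ k), so
    f1 b = f1 a ^ k by injectivity of f2, and the image of G is normal.

    As f2 is bijective with inverse h, the fibre product is the graph of
    h o ft, hence Gt itself as a group.  It is therefore realized as Gt with
    the topology induced by the graph map x |-> (x, h (ft x)); the embedding
    of G is then i itself, with an unchanged, normal, range. *)

Set Implicit Arguments.
Unset Strict Implicit.
Unset Printing Implicit Defensive.

Local Open Scope classical_set_scope.
Local Open Scope group_scope.

Definition graph_map (X Y : Type) (g : X -> Y) (x : X) : X * Y := (x, g x).

(** The morphism proof is a parameter so that the topological group structure
    can be attached to this alias: multiplication and inversion are continuous
    for the graph topology only because g is a morphism. *)
Definition graph_group (G K : topologicalGroupType) (g : G -> K)
  (gM : monoid_morphism g) : Type := G.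

Section GraphGroup.
Context {G K : topologicalGroupType} {g : G -> K} (gM : monoid_morphism g).
Let Gg := graph_group gM.

HB.instance Definition _ := Group.copy Gg G.
HB.instance Definition _ := Topological.copy Gg (initial_topology (graph_map g)).

Lemma graph_group_continuous_id : continuous (id : Gg -> G).
Proof.
move=> x; apply: (@continuous_comp Gg (G * K)%type G (graph_map g) fst).
  exact: initial_continuous.
exact: cvg_fst.
Qed.

Lemma graph_group_continuous_graph : continuous (g : Gg -> K).
Proof.
move=> x; apply: (@continuous_comp Gg (G * K)%type K (graph_map g) snd).
  exact: initial_continuous.
exact: cvg_snd.
Qed.

Lemma continuous_to_graph_group (X : topologicalType) (u : X -> Gg) :
  continuous (u : X -> G) -> continuous (g \o u : X -> K) -> continuous u.
Proof.
move=> cu cgu; apply: continuous_comp_initial => x.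
exact: cvg_pair (cu x) (cgu x).
Qed.

Let morphV (x : G) : g x^-1 = (g x)^-1.
Proof. by apply: (@mulgI _ (g x)); rewrite -gM.2 !mulgV gM.1. Qed.

Lemma graph_group_mulg_continuous : continuous (fun x : Gg * Gg => x.1 * x.2).
Proof.
have comp1 (Z : topologicalType) (u : Gg -> Z) :
  continuous u -> continuous (fun x : Gg * Gg => u x.1).
  by move=> cu x; apply: continuous_comp (cu _); exact: cvg_fst.
have comp2 (Z : topologicalType) (u : Gg -> Z) :
  continuous u -> continuous (fun x : Gg * Gg => u x.2).
  by move=> cu x; apply: continuous_comp (cu _); exact: cvg_snd.
have mul (Z : topologicalGroupType) (u : Gg -> Z) :
  continuous u -> continuous (fun x : Gg * Gg => u x.1 * u x.2).
  move=> cu x.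
  apply: (@continuous_comp _ (Z * Z)%type _ (fun y : Gg * Gg => (u y.1, u y.2))
           (fun z : Z * Z => z.1 * z.2)); last exact: mulg_continuous.
  by apply: cvg_pair; [exact: comp1|exact: comp2].
apply: continuous_to_graph_group.
  exact: (mul G id graph_group_continuous_id).
rewrite (_ : _ \o _ = fun x : Gg * Gg => g x.1 * g x.2).
  exact: (mul K g graph_group_continuous_graph).
by apply/funext => x; exact: gM.2.
Qed.

Lemma graph_group_invg_continuous : continuous (fun x : Gg => x^-1).
Proof.
have inv (Z : topologicalGroupType) (u : Gg -> Z) :
  continuous u -> continuous (fun x : Gg => (u x)^-1).
  move=> cu x; apply: (@continuous_comp _ _ _ u (fun z : Z => z^-1)).
    exact: cu.
  exact: invg_continuous.
apply: continuous_to_graph_group.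
  exact: (inv G id graph_group_continuous_id).
rewrite (_ : _ \o _ = fun x : Gg => (g x)^-1).
  exact: (inv K g graph_group_continuous_graph).
by apply/funext => x; exact: morphV.
Qed.

HB.instance Definition _ := PreTopologicalGroup_isTopologicalGroup.Build Gg
  graph_group_mulg_continuous graph_group_invg_continuous.

Lemma graph_group_continuous_homomorphism :
  continuous_homomorphism (g : Gg -> K).
Proof. by split; [exact: gM|exact: graph_group_continuous_graph]. Qed.

(** Since p is injective, g is the pullback of ft along p: for A open in G and
    B open in K, the image under g of the basic open set of those x in A with
    g x in B is the preimage under p of ft @` A, intersected with B. *)
Lemma graph_group_open_map (H : topologicalType) (p : K -> H) (ft : G -> H) :
    injective p -> continuous p -> (forall x, p (g x) = ft x) ->
  open_map ft -> open_map (g : Gg -> K).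
Proof.
move=> pI cp pg ftO _ [W oW <-]; rewrite openE => _ [x Wx <-].
have [[A B] /= [Ax Bx] ABW] : nbhs (x : G, g x) W by exact: open_nbhs_nbhs.
move: Ax; rewrite nbhsE => -[A' [oA' A'x] A'A].
have : nbhs (g x) (p @^-1` (ft @` A') `&` B).
  apply: filterI => //; apply: open_nbhs_nbhs; split.
    by move/continuousP: cp => cp; apply: cp; exact: ftO.
  by exists x.
apply: filterS => k [[a A'a] fta Bk].
have gak : g a = k by apply: pI; rewrite pg.
by exists a => //; apply: ABW; split; [exact: A'A|rewrite /= gak].
Qed.

(** The underlying group is G, so normality of the range is inherited.  The
    graph topology refines that of G only by preimages under g, and these
    trace open sets on N because g \o i is continuous. *)
Lemma graph_group_topological_normal_embedding
    (N : topologicalGroupType) (i : N -> G) :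
    topological_normal_embedding i -> continuous (g \o i) ->
  topological_normal_embedding (i : N -> Gg).
Proof.
move=> [iM iI iN iO] cgi; split => // U; split.
  move=> /iO[V oV ->]; exists V => //.
  by have /continuousP := graph_group_continuous_id; apply.
move=> [V oV ->].
have /continuousP : continuous (i : N -> Gg); last by apply.
apply: continuous_to_graph_group => //.
by apply/continuousP => A oA; apply/iO; exists A.
Qed.

End GraphGroup.

Theorem theorem6p11 (G K H : topologicalGroupType)
    (f1 : G -> K) (f2 : K -> H) :
  continuous_isomorphism f1 -> continuous_isomorphism f2 ->
  semitopological (f2 \o f1) -> semitopological f1.
Proof.
move=> [f1C [f1' f1K f1'K]] [[f2M f2c] [h f2K hK]].
move=> [_ _ [Gt [i [ft [iE [ftM ftc] ftO fti]]]]].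
have f2I := can_inj f2K.
have gM : monoid_morphism (h \o ft).
  split=> [|x y]; apply: f2I; rewrite /= ?f2M.2 !hK.
    by rewrite ftM.1 f2M.1.
  exact: ftM.2.
have gi : (h \o ft) \o i = f1 by apply/funext => x /=; rewrite fti /= f2K.
split => //; first by move=> k _; exists (f1' k).
exists (graph_group gM), i, (h \o ft); split.
- by apply: graph_group_topological_normal_embedding => //; rewrite gi; case: f1C.
- exact: graph_group_continuous_homomorphism.
- by apply: (graph_group_open_map f2I f2c _ ftO) => x; exact: hK.
- by move=> x; exact: (congr1 (@^~ x) gi).
Qed.
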